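(* Let $\mathcal{A}\subset B(\mathfrak{H})$ be a finite-dimensional operator algebra. Then there is a set of positive integers $\{r_\lambda:\lambda\in\Lambda\}$ and a unital completely isometric linear map $$\Psi:B(\mathfrak{H})\to\prod_{\lambda\in\Lambda}\mathbb{M}_{r_\lambda}$$ such that $$\Psi(a^*tb)=\Psi(a)^*\Psi(t)\Psi(b)$$ for every $a,b\in\mathcal{A}$ and $t\in B(\mathfrak{H})$. Moreover, $\Psi$ restricts to a homomorphism on $\mathcal{A}$.
   Context: An operator algebra is a norm closed subalgebra of $B(\mathfrak{H})$, $\mathfrak{H}$ a complex Hilbert space (not necessarily unital or self-adjoint). The product $\prod_\lambda\mathbb{M}_{r_\lambda}$ consists of bounded families of matrices with the supremum norm. A linear map is completely isometric if all its entrywise ampliations to $n\times n$ matrices are isometric, where $\mathbb{M}_n(B(\mathfrak{H}))$ is normed as $B(\mathfrak{H}^{(n)})$. The family $\{r_\lambda:\lambda\in\Lambda\}$ is an indexed family (repetitions are allowed). *)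

(* Defs.v *)
From HB Require Import structures.
From mathcomp Require Import all_boot all_order all_algebra.
From mathcomp Require Import sesquilinear spectral.
From mathcomp Require Import all_classical all_reals all_analysis.
From mathcomp Require Import complex.

Set Implicit Arguments.
Unset Strict Implicit.
Unset Printing Implicit Defensive.

Import Order.TTheory GRing.Theory Num.Theory.
Import numFieldNormedType.Exports.
Local Open Scope classical_set_scope.
Local Open Scope ring_scope.
Local Open Scope complex_scope.

(* A complex Hilbert space: the inner product is linear in its first argument
   and induces the norm of the underlying Banach space. *)
HB.mixin Record CompleteNormedModule_isHilbert (R : realType) H
    & CompleteNormedModule R[i] H := {
  inner : {dot H for (@Num.conj R[i])} ;
  inner_normE : forall x : H, `|x| ^+ 2 = inner x x
}.

#[short(type="hilbertType")]
HB.structure Definition Hilbert (R : realType) :=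
  {H of CompleteNormedModule R[i] H & CompleteNormedModule_isHilbert R H}.

(* Norms over R[i] take values in R[i]; rnorm is the same norm with values in
   R, where suprema are available. *)
Definition rnorm (R : realType) (V : normedZmodType R[i]) (x : V) : R :=
  complex.Re `|x|.

(* [nu] is a norm on V: the library's norm on a Hilbert space, but an explicit
   l2 norm on 'cV and on direct sums, whose library norm is the sup norm. *)
Definition opnorm (R : realType) (V : Type) (nu : V -> R) (f : V -> V) : R :=
  sup [set nu (f x) | x in [set x | nu x <= 1]].

Definition l2norm (R : realType) (V : Type) (n : nat) (nu : V -> R)
  (x : 'I_n -> V) : R := Num.sqrt (\sum_i nu (x i) ^+ 2).

Section RNorm.
Variables (R : realType) (V : normedZmodType R[i]).
Implicit Types x y : V.

Lemma rnormE x : `|x| = (rnorm x)%:C.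
Proof. by rewrite /rnorm RRe_real // normr_real. Qed.

Lemma rnorm_ge0 x : 0 <= rnorm x.
Proof. by rewrite -ler0c -rnormE. Qed.

Lemma rnormD x y : rnorm (x + y) <= rnorm x + rnorm y.
Proof. by rewrite -lecR rmorphD /= -!rnormE ler_normD. Qed.

Lemma rnorm0 : rnorm (0 : V) = 0.
Proof. by rewrite /rnorm normr0. Qed.

Lemma rnorm_eq0 x : rnorm x = 0 -> x = 0.
Proof. by move=> x0; apply/normr0_eq0; rewrite rnormE x0. Qed.

End RNorm.

Lemma rnormZ (R : realType) (V : normedModType R[i]) (c : R[i]) (x : V) :
  rnorm (c *: x) = rnorm c * rnorm x.
Proof.
by apply/complexI; rewrite rmorphM /= -!rnormE normrZ.
Qed.

Section OpNorm.
Variables (R : realType) (V : lmodType R[i]) (nu : V -> R).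
Hypothesis nu_ge0 : forall x, 0 <= nu x.
Hypothesis nuZ : forall c x, nu (c *: x) = rnorm c * nu x.
Hypothesis nu_eq0 : forall x, nu x = 0 -> x = 0.
Implicit Type f : V -> V.

Let nu0 : nu 0 = 0.
Proof. by rewrite -(scale0r 0) nuZ /rnorm normr0 mul0r. Qed.

Lemma opnorm_le f (M : R) : 0 <= M -> (forall x, nu (f x) <= M * nu x) ->
  opnorm nu f <= M.
Proof.
move=> M0 fM; apply: ge_sup; first by exists (nu (f 0)), 0 => //=; rewrite nu0.
move=> _ /= [x x1 <-]; apply: le_trans (fM x) _.
by rewrite -[leRHS]mulr1 ler_wpM2l.
Qed.

Lemma opnorm_ge0 f : (exists M : R, forall x, nu (f x) <= M * nu x) ->
  0 <= opnorm nu f.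
Proof.
move=> [M fM]; apply: (@le_trans _ _ (nu (f 0))) => //.
apply: ub_le_sup; last by exists 0 => //=; rewrite nu0.
exists `|M| => _ /= [x x1 <-]; apply: le_trans (fM x) _.
rewrite (@le_trans _ _ (`|M| * nu x)) ?ler_wpM2r ?ler_norm //.
by rewrite -[leRHS]mulr1 ler_wpM2l.
Qed.

Lemma le_opnorm f x : scalable f ->
    (exists M : R, forall x, nu (f x) <= M * nu x) ->
  nu (f x) <= opnorm nu f * nu x.
Proof.
move=> fZ [M fM]; have [x0|x0] := eqVneq (nu x) 0.
  by rewrite (nu_eq0 x0) -(scale0r 0) fZ !nuZ /rnorm normr0 !mul0r mulr0.
have nx : 0 < nu x by rewrite lt_def x0 nu_ge0.
have E : rnorm (nu x)^-1%:C = (nu x)^-1.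
  by rewrite /rnorm ger0_norm ?ler0c ?invr_ge0.
rewrite -ler_pdivrMr // mulrC -[X in X * _]E -nuZ -fZ; apply: ub_le_sup.
  exists `|M| => _ /= [y y1 <-]; apply: le_trans (fM y) _.
  rewrite (@le_trans _ _ (`|M| * nu y)) ?ler_wpM2r ?ler_norm //.
  by rewrite -[leRHS]mulr1 ler_wpM2l.
by exists ((nu x)^-1%:C *: x) => //=; rewrite nuZ E mulVf.
Qed.

End OpNorm.

(* A matrix of operators on V acting on the n-fold direct sum of V. *)
Definition amplify (V : zmodType) (n : nat) (T : 'I_n -> 'I_n -> V -> V)
  (x : 'I_n -> V) : 'I_n -> V := fun i => \sum_j T i j (x j).

Section BoundedOperators.
Variables (R : realType) (H : hilbertType R).

Definition bounded_op : {pred H -> H} := fun f =>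
  `[< linear f /\ exists M : R, forall x, rnorm (f x) <= M * rnorm x >].

Record bop := Bop { bop_fun :> H -> H ; _ : bop_fun \in bounded_op }.
HB.instance Definition _ := [isSub for bop_fun].
HB.instance Definition _ := [Choice of bop by <:].


Lemma bopP f : reflect
  (linear f /\ exists M : R, forall x, rnorm (f x) <= M * rnorm x)
  (f \in bounded_op).
Proof. exact: asboolP. Qed.

Fact bounded_op_submod_closed : submod_closed bounded_op.
Proof.
split.
  apply/bopP; split=> [c x y|].
    by rewrite -[LHS]/(0 : H) -[RHS]/(c *: 0 + 0 : H) scaler0 addr0.
  by exists 0 => x; rewrite /rnorm normr0 mul0r.
move=> c f g /bopP[fl [M fM]] /bopP[gl [N gN]]; apply/bopP; split.
  move=> d x y; rewrite -[LHS]/(c *: f (d *: x + y) + g (d *: x + y)).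
  rewrite -[RHS]/(d *: (c *: f x + g x) + (c *: f y + g y)).
  rewrite fl gl !scalerDr !scalerA addrACA.
  by rewrite [d * c]mulrC.
exists (rnorm c * M + N) => x; apply: le_trans (rnormD _ _) _.
rewrite rnormZ mulrDl lerD // -mulrA ler_wpM2l //.
exact: rnorm_ge0.
Qed.

HB.instance Definition _ :=
  GRing.isSubmodClosed.Build R[i] (H -> H) bounded_op bounded_op_submod_closed.
HB.instance Definition _ := [SubChoice_isSubLmodule of bop by <:].

Implicit Types s t : bop.

Lemma bop_linear t : linear t.
Proof. by case: t => f /= /bopP[]. Qed.

HB.instance Definition _ t :=
  GRing.isLinear.Build R[i] H H *:%R t (@bop_linear t).

Lemma bop_bounded t : exists M : R, forall x, rnorm (t x) <= M * rnorm x.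
Proof. by case: t => f /= /bopP[]. Qed.

Lemma bopE s t : (forall x, s x = t x) -> s = t.
Proof. by move=> st; apply/val_inj/funext. Qed.

Lemma bop0E x : (0 : bop) x = 0. Proof. by []. Qed.
Lemma bopDE s t x : (s + t) x = s x + t x. Proof. by []. Qed.
Lemma bopZE (c : R[i]) t x : (c *: t) x = c *: t x. Proof. by []. Qed.

Fact bop_one_subproof : (id : H -> H) \in bounded_op.
Proof. by apply/bopP; split=> //; exists 1 => x; rewrite mul1r. Qed.

Definition bop_one : bop := Bop bop_one_subproof.

Fact bop_mul_subproof s t : (s \o t : H -> H) \in bounded_op.
Proof.
apply/bopP; split=> [c x y|]; first by rewrite /= !linearP.
have [[M sM] [N tN]] := (bop_bounded s, bop_bounded t).
exists (`|M| * N) => x; apply: le_trans (sM _) _.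
apply: (@le_trans _ _ (`|M| * rnorm (t x))).
  by rewrite ler_wpM2r ?rnorm_ge0 ?ler_norm.
by rewrite -mulrA ler_wpM2l.
Qed.

Definition bop_mul s t : bop := Bop (bop_mul_subproof s t).

Fact bop_mulA : associative bop_mul. Proof. by move=> *; apply: bopE. Qed.
Fact bop_mul1r : left_id bop_one bop_mul.
Proof. by move=> *; apply: bopE. Qed.
Fact bop_mulr1 : right_id bop_one bop_mul.
Proof. by move=> *; apply: bopE. Qed.
Fact bop_mulDl : left_distributive bop_mul +%R.
Proof. by move=> *; apply: bopE. Qed.
Fact bop_mulDr : right_distributive bop_mul +%R.
Proof. by move=> s t u; apply: bopE => x; apply: (linearD s). Qed.

HB.instance Definition _ := GRing.Zmodule_isPzRing.Build bop
  bop_mulA bop_mul1r bop_mulr1 bop_mulDl bop_mulDr.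

Lemma bop1E x : (1 : bop) x = x. Proof. by []. Qed.
Lemma bopME s t x : (s * t) x = s (t x). Proof. by []. Qed.

Definition bop_norm t : R[i] := (opnorm (@rnorm R H) t)%:C.

Fact bop_norm_le t x : rnorm (t x) <= opnorm (@rnorm R H) t * rnorm x.
Proof.
apply: le_opnorm (bop_bounded t); first exact: rnorm_ge0.
- exact: rnormZ.
- exact: rnorm_eq0.
- exact: linearZ_LR.
Qed.

Fact bop_opnorm_ge0 t : 0 <= opnorm (@rnorm R H) t.
Proof.
by apply: opnorm_ge0 (bop_bounded t); [exact: rnorm_ge0 | exact: rnormZ].
Qed.

Fact bop_ler_normD s t : bop_norm (s + t) <= bop_norm s + bop_norm t.
Proof.
rewrite -rmorphD /= lecR; apply: opnorm_le; first exact: rnormZ.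
  by rewrite addr_ge0 ?bop_opnorm_ge0.
move=> x; rewrite bopDE; apply: le_trans (rnormD _ _) _.
by rewrite mulrDl lerD ?bop_norm_le.
Qed.

Fact bop_normrZ (c : R[i]) t : bop_norm (c *: t) = `|c| * bop_norm t.
Proof.
rewrite rnormE -rmorphM /=; congr (_%:C).
have le (d : R[i]) (u : bop) : opnorm (@rnorm R H) (d *: u : bop) <=
    rnorm d * opnorm (@rnorm R H) u.
  apply: opnorm_le => [||x]; first exact: rnormZ.
    by rewrite mulr_ge0 ?rnorm_ge0 ?bop_opnorm_ge0.
  by rewrite bopZE rnormZ -mulrA ler_wpM2l ?rnorm_ge0 ?bop_norm_le.
apply/eqP; rewrite eq_le le andTb; have [->|c0] := eqVneq c 0.
  by rewrite rnorm0 mul0r bop_opnorm_ge0.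
have rc : 0 < rnorm c.
  rewrite lt_def rnorm_ge0 andbT; apply: contra c0 => /eqP.
  by move/rnorm_eq0 ->.
rewrite -ler_pdivlMl // -[in leLHS](scalerK c0 t).
apply: le_trans (le _ _) _; rewrite le_eqVlt; apply/orP; left; apply/eqP.
congr (_ * _); apply/complexI.
by rewrite -rnormE normfV rnormE fmorphV.
Qed.

Fact bop_normr0_eq0 t : bop_norm t = 0 -> t = 0.
Proof.
move=> /complexI t0; apply: bopE => x; apply: rnorm_eq0; apply/eqP.
by rewrite eq_le rnorm_ge0 andbT -[leRHS](mul0r (rnorm x)) -t0 bop_norm_le.
Qed.

HB.instance Definition _ := Lmodule_isNormed.Build R[i] bop
  bop_ler_normD bop_normrZ bop_normr0_eq0.

End BoundedOperators.

Section Riesz.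
Variables (R : realType) (H : hilbertType R).
Implicit Types u v w x y z : H.

Lemma inner_rnorm x : (rnorm x ^+ 2)%:C = inner x x.
Proof. by rewrite rmorphXn /= -rnormE inner_normE. Qed.

Lemma parallelogram u v :
  rnorm (u - v) ^+ 2 = (rnorm u ^+ 2 + rnorm v ^+ 2) *+ 2 - rnorm (u + v) ^+ 2.
Proof.
apply/complexI; rewrite rmorphB rmorphMn rmorphD /= !inner_rnorm.
rewrite (dnormB inner) (dnormD inner).
by rewrite mulr2n [in RHS]opprD [in RHS]addrA addrK.
Qed.

Lemma inner_proj z w : w != 0 ->
  inner (z - (inner z w / inner w w) *: w) (z - (inner z w / inner w w) *: w) =
  inner z z - `|inner z w| ^+ 2 / inner w w.
Proof.
move=> wN; have n0 : 0 < inner w w by rewrite dnorm_gt0.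
set a := inner z w; set n := inner w w in n0 *; set c := a / n.
have nR : Num.conj n = n by apply/CrealP; rewrite gtr0_real.
have dE : inner z (c *: w) = `|a| ^+ 2 / n.
  by rewrite linearZr_LR /= -/a /c rmorphM fmorphV /= nR normCKC mulrAC.
have dR : Num.conj (`|a| ^+ 2 / n) = `|a| ^+ 2 / n.
  by apply/CrealP; rewrite ger0_real // divr_ge0 ?exprn_ge0 // ltW.
rewrite (dnormB inner) (dnormZ inner) dE -/n /c normrM exprMn normfV.
rewrite (gtr0_norm n0) expr2 [n^-1 ^+ 2]expr2 -!mulrA mulVf ?gt_eqF // mulr1.
by rewrite mulrA -expr2 dR opprD addrA addrK.
Qed.

Lemma inner_le x y : rnorm (inner x y) <= rnorm x * rnorm y.
Proof.
have [->|yN] := eqVneq y 0; first by rewrite linear0r !rnorm0 mulr0.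
have n0 : 0 < inner y y by rewrite dnorm_gt0.
rewrite -(@ler_pXn2r _ 2) ?nnegrE ?mulr_ge0 ?rnorm_ge0 // -lecR exprMn.
rewrite [leRHS]rmorphM /= !inner_rnorm rmorphXn /= -rnormE -ler_pdivrMr // -subr_ge0.
by rewrite -(inner_proj x yN) dnorm_ge0.
Qed.

Lemma Riesz (phi : H -> R[i]) :
    (forall c x y, phi (c *: x + y) = c * phi x + phi y) ->
    (exists M : R, forall x, rnorm (phi x) <= M * rnorm x) ->
  exists y, forall x, phi x = inner x y.
Proof.
move=> phiL [M0 phiM0].
have phi0 : phi 0 = 0.
  by have := phiL (-1) 0 0; rewrite scaler0 addr0 mulN1r addNr.
have phiD x y : phi (x + y) = phi x + phi y.
  by rewrite -[x]scale1r phiL scale1r mul1r.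
have phiZ c x : phi (c *: x) = c * phi x.
  by rewrite -[_ *: _]addr0 phiL phi0 addr0.
have phiB x y : phi (x - y) = phi x - phi y.
  by rewrite phiD -scaleN1r phiZ mulN1r.
pose M := `|M0| + 1.
have Mgt0 : 0 < M by rewrite ltr_wpDl.
have phiM x : rnorm (phi x) <= M * rnorm x.
  apply: le_trans (phiM0 x) _; rewrite ler_wpM2r ?rnorm_ge0 //.
  by rewrite (le_trans (ler_norm _)) // lerDl.
have [[x0 x0N]|all0] := pselect (exists x, phi x != 0); last first.
  exists 0 => x; rewrite linear0r; apply/eqP/negPn/negP => xN.
  by apply: all0; exists x.
pose K := [set x | phi x = 1].
have K0 : K !=set0.
  by exists ((phi x0)^-1 *: x0); rewrite /K /= phiZ mulVf.
pose D := inf [set rnorm x | x in K].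
have Dlb x : K x -> D <= rnorm x.
  move=> Kx; apply: ge_inf; last by exists x.
  by exists 0 => _ [y _ <-]; apply: rnorm_ge0.
have D_ge0 : 0 <= D.
  apply: lb_le_inf; first by case: K0 => x Kx; exists (rnorm x), x.
  by move=> _ [y _ <-]; apply: rnorm_ge0.
have Dap (e : R) : 0 < e -> exists2 x, K x & rnorm x < D + e.
  move=> e0; have hi : has_inf [set rnorm x | x in K].
    split; first by case: K0 => x Kx; exists (rnorm x), x.
    by exists 0 => _ [y _ <-]; apply: rnorm_ge0.
  have [_ [x Kx <-] xe] := inf_adherent e0 hi.
  by exists x.
pose B (e : R) := [set x | K x /\ rnorm x < D + e].
pose F : set_system H := filter_from [set e : R | 0 < e] B.
have FF : ProperFilter F.
  apply: filter_from_proper; last first.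
    by move=> e /= /Dap[x Kx xe]; exists x.
  apply: filter_from_filter; first by exists 1 => /=.
  move=> e f /= e0 f0; exists (Num.min e f); first by rewrite /= lt_min e0.
  move=> x [Kx xe]; split; split=> //; apply: lt_le_trans xe _;
    by rewrite lerD2l ge_min lexx ?orbT.
have Bdist (e : R) u v : B e u -> B e v ->
    rnorm (u - v) ^+ 2 < ((D + e) ^+ 2 - D ^+ 2) *+ 4.
  move=> [Ku ue] [Kv ve]; rewrite parallelogram.
  have De : 0 <= D + e by apply: le_trans (ltW ue); apply: rnorm_ge0.
  have h : D *+ 2 <= rnorm (u + v).
    have /Dlb : K (2^-1 *: (u + v)).
      have two0 : (2 : R[i]) != 0 by rewrite pnatr_eq0.
      by rewrite /K /= phiZ phiD Ku Kv; apply: mulVf two0.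
    have -> : 2^-1 = ((2^-1 : R)%:C) :> R[i] by rewrite fmorphV rmorph_nat.
    rewrite rnormZ {1}/rnorm ger0_norm ?ler0c ?invr_ge0 ?ler0n //=.
    by rewrite ler_pdivlMl ?ltr0n // mulr_natl.
  rewrite mulrnBl; apply: ltr_leB; last first.
    rewrite -[4%N]/(2 * 2)%N -[X in X <= _]mulr_natl natrM -expr2.
    by rewrite -exprMn mulr_natl ler_pXn2r ?nnegrE ?mulrn_wge0 ?rnorm_ge0.
  rewrite -[4%N]/(2 * 2)%N mulrnA ltrMn2r /= mulr2n.
  by apply: ltrD; rewrite ltr_pXn2r ?nnegrE ?rnorm_ge0.
have Fc : cauchy F.
  apply/cauchyP => e e0.
  have eE : e = (complex.Re e)%:C by rewrite RRe_real // gtr0_real.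
  move: (complex.Re e) eE e0 => r ->; rewrite ltcR => r0.
  pose del := Num.min 1 (r ^+ 2 / (D *+ 8 + 4)).
  have D8 : 0 < D *+ 8 + 4 by rewrite ltr_wpDl ?mulrn_wge0 ?ltr0n.
  have del0 : 0 < del by rewrite lt_min ltr01 divr_gt0 ?exprn_gt0.
  have [x Kx xe] := Dap _ del0; exists x; exists del => // y By.
  rewrite -ball_normE /= rnormE ltcR.
  rewrite -(@ltr_pXn2r _ 2) ?nnegrE ?rnorm_ge0 ?ltW //.
  apply: lt_le_trans (Bdist _ _ _ (conj Kx xe) By) _.
  apply: (@le_trans _ _ (del * (D *+ 8 + 4))); last first.
    by rewrite -ler_pdivlMr // ge_min lexx orbT.
  have -> : ((D + del) ^+ 2 - D ^+ 2) *+ 4 = del * (D *+ 8) + (del * del) *+ 4.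
    rewrite sqrrD -(addrA (D ^+ 2)) addrAC subrr add0r.
    by rewrite mulrnDl -mulrnA mulrnAr [D * _]mulrC expr2.
  rewrite (mulrDr del (D *+ 8) 4) lerD2l -mulr_natr ler_wpM2r ?ler0n //.
  by rewrite -[leRHS]mulr1 ler_wpM2l ?(ltW del0) // ge_min lexx.
have [z Fz] : exists z : H, F --> z by apply/cvg_ex; exact: cauchy_cvg Fc.
have zap (e : R) : 0 < e -> exists u, [/\ K u, rnorm u < D + e & rnorm (z - u) < e].
  move=> e0.
  have Fb : F (ball z e%:C) by apply: Fz; apply: nbhsx_ballx; rewrite ltcR.
  have FB : F (B e) by exists e.
  have [u [zu [Ku ue]]] := filter_ex (filterI Fb FB).
  exists u; split=> //; move: zu; rewrite -ball_normE /= rnormE.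
  by rewrite ltcR.
have Kz : phi z = 1.
  apply/eqP; rewrite -subr_eq0; apply/eqP/rnorm_eq0/eqP.
  rewrite eq_le rnorm_ge0 andbT; apply/ler_addgt0Pr => e e0; rewrite add0r.
  have [|u [Ku _ zu]] := zap (e / M); first by rewrite divr_gt0.
  rewrite -Ku -phiB; apply: le_trans (phiM _) _.
  by rewrite -ler_pdivlMl // mulrC ltW.
have zD : rnorm z = D.
  apply/eqP; rewrite eq_le Dlb // andbT; apply/ler_addgt0Pr => e e0.
  have [|u [_ uD zu]] := zap (e / 2); first by rewrite divr_gt0.
  rewrite -[z](subrK u); apply: le_trans (rnormD _ _) _.
  by rewrite (splitr e) addrCA lerD ?ltW // addrC.
have orth w : phi w = 0 -> inner z w = 0.
  move=> w0; apply/eqP/negPn/negP => a0.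
  have wN : w != 0 by apply: contra a0 => /eqP ->; rewrite linear0r.
  have n0 : 0 < inner w w by rewrite dnorm_gt0.
  set a := inner z w in a0; set n := inner w w in n0.
  pose c := a / n.
  have Kc : K (z - c *: w) by rewrite /K /= phiB phiZ w0 mulr0 subr0.
  have := Dlb _ Kc; rewrite -zD leNgt => /negP; apply.
  rewrite -(@ltr_pXn2r _ 2) ?nnegrE ?rnorm_ge0 // -ltcR !inner_rnorm.
  rewrite (inner_proj z wN) -/a -/n.
  by rewrite gtrDl oppr_lt0 divr_gt0 ?exprn_gt0 ?normr_gt0.
have zz0 : inner z z != 0.
  rewrite dnorm_eq0; apply/eqP => zE; have := Kz; rewrite zE phi0.
  by move/eqP; rewrite eq_sym oner_eq0.
exists ((inner z z)^-1 *: z) => x.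
have := orth (x - phi x *: z); rewrite phiB phiZ Kz mulr1 subrr => /(_ erefl).
rewrite linearBr linearZr_LR /= => /eqP; rewrite subr_eq0 => /eqP xz.
have zzR : Num.conj (inner z z) = inner z z.
  by apply/CrealP; rewrite ger0_real // dnorm_ge0.
rewrite linearZr_LR /= fmorphV /= zzR -[inner x z]conjCK.
have -> : Num.conj (inner x z) = inner z x.
  by rewrite [RHS](hermC inner) expr0 mul1r.
by rewrite xz rmorphM /= conjCK zzR mulrCA mulVf ?mulr1.
Qed.

End Riesz.

Section EuclideanNorm.
Variable R : realType.
Local Notation C := R[i].

Definition euclid (k : nat) (v : 'cV[C]_k) : R :=
  l2norm (@rnorm R C) (fun i => v i 0).

Variable k : nat.
Implicit Types v w : 'cV[C]_k.

Lemma euclid_ge0 v : 0 <= euclid v.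
Proof. exact: sqrtr_ge0. Qed.

Lemma euclid_sqr v : euclid v ^+ 2 = \sum_i rnorm (v i 0) ^+ 2.
Proof. by rewrite sqr_sqrtr // sumr_ge0 // => i _; rewrite sqr_ge0. Qed.

Lemma euclid_dotmx v : (euclid v ^+ 2)%:C = dotmx v^T v^T.
Proof.
rewrite euclid_sqr dotmxE mxE rmorph_sum /=; apply: eq_bigr => i _.
by rewrite rmorphXn /= -rnormE !mxE normCK.
Qed.

Lemma euclidE v : (euclid v)%:C = sqrtC (dotmx v^T v^T).
Proof.
by rewrite -euclid_dotmx rmorphXn /= sqrCK // ler0c euclid_ge0.
Qed.

Lemma euclidD v w : euclid (v + w) <= euclid v + euclid w.
Proof.
rewrite -lecR rmorphD /= !euclidE linearD /=.
by have [] := triangle_lerif (@dotmx C k) v^T w^T.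
Qed.

Lemma rnormM (a b : C) : rnorm (a * b) = rnorm a * rnorm b.
Proof. by apply/complexI; rewrite rmorphM /= -!rnormE normrM. Qed.

Lemma euclidZ (c : C) v : euclid (c *: v) = rnorm c * euclid v.
Proof.
apply/eqP; rewrite -(@eqrXn2 _ 2) ?mulr_ge0 ?rnorm_ge0 ?euclid_ge0 //.
rewrite exprMn !euclid_sqr mulr_sumr; apply/eqP/eq_bigr => i _.
by rewrite mxE rnormM exprMn.
Qed.

Lemma euclid_eq0 v : euclid v = 0 -> v = 0.
Proof.
move=> v0; have: dotmx v^T v^T == 0 by rewrite -euclid_dotmx v0 expr0n.
by rewrite dnorm_eq0 => /eqP/(congr1 trmx); rewrite trmxK trmx0.
Qed.

Lemma euclid_CS v w : rnorm (dotmx v^T w^T) <= euclid v * euclid w.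
Proof.
rewrite -lecR rmorphM /= -rnormE !euclidE.
by have [] := CauchySchwarz_sqrt (@dotmx C k) v^T w^T.
Qed.

End EuclideanNorm.

Section MatrixNorm.
Variable R : realType.
Local Notation C := R[i].

Definition mx_opnorm (k : nat) (A : 'M[C]_k) : R :=
  opnorm (@euclid R k) (mulmx A).

Variable k : nat.
Implicit Types A B : 'M[C]_k.

Lemma dot_mulmx A (v w : 'cV[C]_k) :
  dotmx (A *m v)^T w^T = dotmx v^T (map_mx Num.conj A^T *m w)^T.
Proof.
rewrite !dotmxE !trmxK trmx_mul map_mxM -mulmxA.
congr ((_ *m (_ *m _)) 0 0).
by apply/matrixP => i j; rewrite !mxE [RHS]conjCK.
Qed.

Lemma mx_bounded A : exists M : R, forall v, euclid (A *m v) <= M * euclid v.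
Proof.
exists (Num.sqrt (\sum_i (\sum_j rnorm (A i j)) ^+ 2)) => v.
have S0 (i : 'I_k) : 0 <= \sum_j rnorm (A i j).
  by rewrite sumr_ge0 // => j _; apply: rnorm_ge0.
apply: (@le_trans _ _
  (Num.sqrt (\sum_i ((\sum_j rnorm (A i j)) * euclid v) ^+ 2))).
  apply: ler_wsqrtr; apply: ler_sum => i _.
  rewrite ler_pXn2r ?nnegrE ?mulr_ge0 ?euclid_ge0 ?S0 ?rnorm_ge0 // mxE.
  apply: (@le_trans _ _ (\sum_j rnorm (A i j * v j 0))).
    elim/big_ind2: _ => [|x a y b xa yb|//]; first by rewrite rnorm0.
    by apply: le_trans (rnormD _ _) _; rewrite lerD.
  rewrite mulr_suml; apply: ler_sum => j _; rewrite rnormM.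
  rewrite ler_wpM2l ?rnorm_ge0 //.
  rewrite -(@ler_pXn2r _ 2) ?nnegrE ?rnorm_ge0 ?euclid_ge0 // euclid_sqr.
  by rewrite (bigD1 j) //= lerDl sumr_ge0 // => l _; apply: sqr_ge0.
rewrite -[X in _ * X]ger0_norm ?euclid_ge0 // -sqrtr_sqr -sqrtrM.
  by rewrite mulr_suml; under eq_bigr do rewrite exprMn.
by rewrite sumr_ge0 // => i _; apply: sqr_ge0.
Qed.

Lemma mx_opnorm_ge0 A : 0 <= mx_opnorm A.
Proof.
by apply: opnorm_ge0 (mx_bounded A); [exact: euclid_ge0 | exact: euclidZ].
Qed.

Lemma le_mx_opnorm A v : euclid (A *m v) <= mx_opnorm A * euclid v.
Proof.
apply: (@le_opnorm _ _ (@euclid R k) _ _ _ (mulmx A) v _ (mx_bounded A)).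
- exact: euclid_ge0.
- exact: euclidZ.
- exact: euclid_eq0.
- by move=> c w; rewrite -scalemxAr.
Qed.

Lemma mx_opnorm_le A (M : R) : 0 <= M ->
  (forall v, euclid (A *m v) <= M * euclid v) -> mx_opnorm A <= M.
Proof. by apply: opnorm_le; exact: euclidZ. Qed.

Lemma mx_opnorm0 : mx_opnorm (0 : 'M[C]_k) <= 0.
Proof.
apply: mx_opnorm_le => // v.
by rewrite mul0mx mul0r -(scale0r 0) euclidZ rnorm0 mul0r.
Qed.

Lemma mx_opnorm1 : mx_opnorm (1 : 'M[C]_k) <= 1.
Proof. by apply: mx_opnorm_le => // v; rewrite mul1mx mul1r. Qed.

Lemma mx_opnormD A B : mx_opnorm (A + B) <= mx_opnorm A + mx_opnorm B.
Proof.
apply: mx_opnorm_le; first by rewrite addr_ge0 ?mx_opnorm_ge0.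
move=> v; rewrite mulmxDl mulrDl; apply: le_trans (euclidD _ _) _.
by rewrite lerD ?le_mx_opnorm.
Qed.

Lemma mx_opnormZ (c : C) A : mx_opnorm (c *: A) <= rnorm c * mx_opnorm A.
Proof.
apply: mx_opnorm_le => [|v]; first by rewrite mulr_ge0 ?mx_opnorm_ge0 ?rnorm_ge0.
by rewrite -scalemxAl euclidZ -mulrA ler_wpM2l ?rnorm_ge0 ?le_mx_opnorm.
Qed.

Lemma mx_opnormM A B : mx_opnorm (A * B) <= mx_opnorm A * mx_opnorm B.
Proof.
apply: mx_opnorm_le => [|v]; first by rewrite mulr_ge0 ?mx_opnorm_ge0.
rewrite -mulmxA -mulrA; apply: le_trans (le_mx_opnorm _ _) _.
by rewrite ler_wpM2l ?mx_opnorm_ge0 ?le_mx_opnorm.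
Qed.

Lemma mx_opnormC A : mx_opnorm (map_mx Num.conj A^T) <= mx_opnorm A.
Proof.
apply: mx_opnorm_le => [|v]; first exact: mx_opnorm_ge0.
set B := map_mx _ _; have [->|w0] := eqVneq (euclid (B *m v)) 0.
  by rewrite mulr_ge0 ?mx_opnorm_ge0 ?euclid_ge0.
have wgt : 0 < euclid (B *m v) by rewrite lt_def w0 euclid_ge0.
rewrite -(ler_pM2l wgt) -expr2.
have -> : euclid (B *m v) ^+ 2 = rnorm (dotmx (A *m (B *m v))^T v^T).
  apply/complexI; rewrite dot_mulmx -/B -euclid_dotmx -rnormE ger0_norm //.
  by rewrite ler0c sqr_ge0.
apply: le_trans (euclid_CS _ _) _; rewrite mulrA [_ * mx_opnorm A]mulrC.
by rewrite ler_wpM2r ?euclid_ge0 ?le_mx_opnorm.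
Qed.

End MatrixNorm.

Section MatrixProduct.
Variables (R : realType) (L : Type) (r : L -> nat).
Local Notation C := R[i].

(* The factors are algebras of operators on the Euclidean spaces C^(r l), so
   boundedness refers to the operator norm of matrices. *)
Record mxprod := MxProd {
  mxfam :> forall l, 'M[C]_(r l) ;
  mxfam_bounded : exists M : R, forall l, mx_opnorm (mxfam l) <= M
}.
HB.instance Definition _ := gen_eqMixin mxprod.
HB.instance Definition _ := gen_choiceMixin mxprod.

Implicit Types x y z : mxprod.

Lemma mxprodE x y : (forall l, x l = y l) -> x = y.
Proof.
case: x y => [x xb] [y yb] /= xy.
have E : x = y by apply: functional_extensionality_dep.
by case: _ / E yb => yb; congr MxProd; apply: Prop_irrelevance.
Qed.

Program Definition mxprod_zero := @MxProd (fun=> 0) _.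
Next Obligation. by exists 0 => l; apply: mx_opnorm0. Qed.

Program Definition mxprod_one := @MxProd (fun=> 1) _.
Next Obligation. by exists 1 => l; apply: mx_opnorm1. Qed.

Program Definition mxprod_add x y := @MxProd (fun l => x l + y l) _.
Next Obligation.
move=> x y; have [[M xM] [N yN]] := (mxfam_bounded x, mxfam_bounded y).
by exists (M + N) => l; apply: le_trans (mx_opnormD _ _) _; rewrite lerD.
Qed.

Program Definition mxprod_scale (c : C) x := @MxProd (fun l => c *: x l) _.
Next Obligation.
move=> c x; have [M xM] := mxfam_bounded x; exists (rnorm c * M) => l.
by apply: le_trans (mx_opnormZ _ _) _; rewrite ler_wpM2l ?rnorm_ge0.
Qed.

Program Definition mxprod_opp x := @MxProd (fun l => - x l) _.
Next Obligation.
move=> x; have [M xM] := mxfam_bounded (mxprod_scale (-1) x).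
by exists M => l; have := xM l; rewrite /= scaleN1r.
Qed.

Program Definition mxprod_mul x y := @MxProd (fun l => x l * y l) _.
Next Obligation.
move=> x y; have [[M xM] [N yN]] := (mxfam_bounded x, mxfam_bounded y).
exists (M * N) => l; apply: le_trans (mx_opnormM _ _) _.
by rewrite ler_pM ?mx_opnorm_ge0.
Qed.

Program Definition mxprod_adj x :=
  @MxProd (fun l => map_mx Num.conj (x l)^T) _.
Next Obligation.
move=> x; have [M xM] := mxfam_bounded x.
by exists M => l; apply: le_trans (mx_opnormC _) _.
Qed.

Fact mxprod_addA : associative mxprod_add.
Proof. by move=> *; apply: mxprodE => l /=; rewrite addrA. Qed.
Fact mxprod_addC : commutative mxprod_add.
Proof. by move=> *; apply: mxprodE => l /=; rewrite addrC. Qed.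
Fact mxprod_add0 : left_id mxprod_zero mxprod_add.
Proof. by move=> *; apply: mxprodE => l /=; rewrite add0r. Qed.
Fact mxprod_addN : left_inverse mxprod_zero mxprod_opp mxprod_add.
Proof. by move=> *; apply: mxprodE => l /=; rewrite addNr. Qed.

HB.instance Definition _ := GRing.isZmodule.Build mxprod
  mxprod_addA mxprod_addC mxprod_add0 mxprod_addN.

Fact mxprod_scaleA a b x :
  mxprod_scale a (mxprod_scale b x) = mxprod_scale (a * b) x.
Proof. by apply: mxprodE => l /=; rewrite scalerA. Qed.
Fact mxprod_scale1 : left_id 1 mxprod_scale.
Proof. by move=> x; apply: mxprodE => l /=; rewrite scale1r. Qed.
Fact mxprod_scaleDr : right_distributive mxprod_scale +%R.
Proof. by move=> c x y; apply: mxprodE => l; apply: scalerDr. Qed.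
Fact mxprod_scaleDl x : {morph mxprod_scale^~ x : a b / a + b}.
Proof. by move=> a b; apply: mxprodE => l; apply: scalerDl. Qed.

HB.instance Definition _ := GRing.Zmodule_isLmodule.Build C mxprod
  mxprod_scaleA mxprod_scale1 mxprod_scaleDr mxprod_scaleDl.

Fact mxprod_mulA : associative mxprod_mul.
Proof. by move=> *; apply: mxprodE => l /=; rewrite mulrA. Qed.
Fact mxprod_mul1r : left_id mxprod_one mxprod_mul.
Proof. by move=> *; apply: mxprodE => l /=; rewrite mul1r. Qed.
Fact mxprod_mulr1 : right_id mxprod_one mxprod_mul.
Proof. by move=> *; apply: mxprodE => l /=; rewrite mulr1. Qed.
Fact mxprod_mulDl : left_distributive mxprod_mul +%R.
Proof. by move=> *; apply: mxprodE => l; apply: mulrDl. Qed.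
Fact mxprod_mulDr : right_distributive mxprod_mul +%R.
Proof. by move=> *; apply: mxprodE => l; apply: mulrDr. Qed.

HB.instance Definition _ := GRing.Zmodule_isPzRing.Build mxprod
  mxprod_mulA mxprod_mul1r mxprod_mulr1 mxprod_mulDl mxprod_mulDr.

(* The supremum over l of the norms in M_n(M_(r l)), acting on the n-fold direct
   sum of C^(r l). For n = 1 this is the supremum norm of the product; it is 0
   when L is empty. *)
Definition mxprod_mxnorm (n : nat) (X : 'M[mxprod]_n) : R :=
  sup (range (fun l => opnorm (l2norm (@euclid R (r l)))
    (amplify (fun i j v => X i j l *m v)))).

End MatrixProduct.

Section OperatorAlgebras.
Variables (R : realType) (H : hilbertType R).

(* M_n(B(H)) is normed as B(H^(n)). *)
Definition bop_mxnorm (n : nat) (T : 'M[bop H]_n) : R :=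
  opnorm (l2norm (@rnorm R H)) (amplify (fun i j => T i j)).

Lemma ex_adjoint (t : bop H) :
  exists s : bop H, forall x y, inner (t x) y = inner x (s y).
Proof.
have [M tM] := bop_bounded t.
have /choice[s sE] y : exists z, forall x, inner (t x) y = inner x z.
  apply: Riesz => [c u v|]; first by rewrite linearP linearDl linearZl_LR.
  exists (M * rnorm y) => x; apply: le_trans (inner_le _ _) _.
  by rewrite mulrAC ler_wpM2r ?rnorm_ge0.
have inj u v : (forall x, inner x u = inner x v) -> u = v.
  move=> uv; apply/eqP; rewrite -subr_eq0 -(dnorm_eq0 inner) linearBr /=.
  by rewrite uv subrr.
suff sb : s \in @bounded_op R H by exists (Bop sb) => x y; apply: sE.
apply/bopP; split=> [c u v|].
  apply: inj => x; rewrite -sE linearDr linearZr_LR /= !sE.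
  by rewrite linearDr linearZr_LR.
exists `|M| => y; have [->|sN] := eqVneq (rnorm (s y)) 0.
  by rewrite mulr_ge0 ?rnorm_ge0.
have s0 : 0 < rnorm (s y) by rewrite lt_def sN rnorm_ge0.
rewrite -(ler_pM2l s0) -expr2.
have -> : rnorm (s y) ^+ 2 = rnorm (inner (t (s y)) y).
  by apply/complexI; rewrite inner_rnorm sE -rnormE ger0_norm // dnorm_ge0.
apply: le_trans (inner_le _ _) _; rewrite mulrA ler_wpM2r ?rnorm_ge0 //.
by rewrite mulrC; apply: le_trans (tM _) _; rewrite ler_wpM2r ?rnorm_ge0 ?ler_norm.
Qed.

Definition adjoint (t : bop H) : bop H := sval (cid (ex_adjoint t)).

Lemma adjointP (t : bop H) x y : inner (t x) y = inner x (adjoint t y).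
Proof. by rewrite /adjoint; case: cid => s /=. Qed.

(* No unit and no stability under adjoints is required; [closed] refers to the
   operator-norm topology on [bop H]. *)
Definition operator_algebra (A : set (bop H)) : Prop :=
  [/\ A 0, forall (c : R[i]) a b, A a -> A b -> A (c *: a + b),
      forall a b, A a -> A b -> A (a * b) & closed A].

Definition finite_dimensional (V : lmodType R[i]) (A : set V) : Prop :=
  exists (n : nat) (e : 'I_n -> V),
    A = [set \sum_i c i *: e i | c in [set: 'I_n -> R[i]]].

Definition completely_isometric (L : Type) (r : L -> nat)
    (Psi : bop H -> mxprod R r) : Prop :=
  forall (n : nat) (T : 'M[bop H]_n),
    mxprod_mxnorm (map_mx Psi T) = bop_mxnorm T.

End OperatorAlgebras.

(* Main.v *)
Require Import Defs.
From HB Require Import structures.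
From mathcomp Require Import all_boot all_order all_algebra.
From mathcomp Require Import sesquilinear.
From mathcomp Require Import all_classical all_reals all_analysis.
From mathcomp Require Import complex.

Set Implicit Arguments.
Unset Strict Implicit.
Unset Printing Implicit Defensive.

Import Order.TTheory GRing.Theory Num.Theory.
Local Open Scope ring_scope.
Local Open Scope complex_scope.

(* Since A is finite-dimensional, the subspace K = F + A F is finite-dimensional
   and A-invariant for every finite-dimensional F in H. If P is the projection
   onto such a K, then b K lies in K for b in A, so b P = P b P and
   P a^* = P a^* P for a, b in A, whence the compression t |-> P t P is a
   unital map with P a^* t b P = (P a P)^* (P t P) (P b P). Psi is the product of
   the compressions to all nonzero finite-dimensional invariant K, each given by
   an orthonormal basis. It is completely isometric because a vector x of H^n and
   its image T x have their entries in a common K. *)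

(** * The l2 norm on finite direct sums *)

Section L2Norm.
Variables (R : realType) (V : lmodType R[i]) (nu : V -> R) (n : nat).
Hypothesis nu_ge0 : forall x, 0 <= nu x.
Hypothesis nuZ : forall c x, nu (c *: x) = rnorm c * nu x.
Hypothesis nu_eq0 : forall x, nu x = 0 -> x = 0.
Implicit Type x : 'I_n -> V.

Lemma l2norm_ge0 x : 0 <= l2norm nu x.
Proof. exact: sqrtr_ge0. Qed.

Lemma l2normZ (c : R[i]) x : l2norm nu (c *: x) = rnorm c * l2norm nu x.
Proof.
rewrite /l2norm; under eq_bigr do rewrite fctE nuZ exprMn.
by rewrite -mulr_sumr sqrtrM ?sqr_ge0 // sqrtr_sqr ger0_norm ?rnorm_ge0.
Qed.

Lemma l2norm_eq0 x : l2norm nu x = 0 -> x = 0.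
Proof.
move=> /eqP; rewrite sqrtr_eq0 => x0; apply/funext => i; apply/nu_eq0/eqP.
rewrite -sqrf_eq0 eq_le sqr_ge0 andbT; apply: le_trans x0.
by rewrite (bigD1 i) //= lerDl sumr_ge0 // => j _; apply: sqr_ge0.
Qed.

Lemma le_l2norm x i : nu (x i) <= l2norm nu x.
Proof.
rewrite -[leLHS](ger0_norm (nu_ge0 _)) -sqrtr_sqr ler_wsqrtr //.
by rewrite (bigD1 i) //= lerDl sumr_ge0 // => j _; apply: sqr_ge0.
Qed.

(** Each term is at most the whole sum, so its square is at most the term times the sum. *)
Lemma l2norm_le_sum x : l2norm nu x <= \sum_i nu (x i).
Proof.
have S0 : 0 <= \sum_i nu (x i) by apply: sumr_ge0.
rewrite -[leRHS](ger0_norm S0) -sqrtr_sqr ler_wsqrtr // expr2 mulr_suml.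
apply: ler_sum => i _; rewrite expr2 ler_wpM2l // (bigD1 i) //= lerDl.
exact: sumr_ge0.
Qed.

End L2Norm.

(** * Boundedness of matrices of operators *)

Lemma amplify_scalable (K : pzRingType) (V : lmodType K) (n : nat)
    (T : 'I_n -> 'I_n -> V -> V) :
  (forall i j, scalable (T i j)) -> scalable (amplify T).
Proof.
move=> TZ c x; apply/funext => i; rewrite -[RHS]/(c *: amplify T x i) scaler_sumr.
by apply: eq_bigr => j _; rewrite fctE TZ.
Qed.

Section BopAmplify.
Variables (R : realType) (H : hilbertType R) (n : nat) (T : 'M[bop H]_n).

(** A crude bound, the sum of the norms of all entries, is enough to make the supremum in
    [bop_mxnorm] that of a bounded set. *)
Lemma bop_amplify_bounded : exists M : R, forall x : 'I_n -> H,
  l2norm (@rnorm R H) (amplify (fun i j => T i j) x) <=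
  M * l2norm (@rnorm R H) x.
Proof.
exists (\sum_i \sum_j opnorm (@rnorm R H) (T i j)) => x.
apply: le_trans (l2norm_le_sum _ _) _; first exact: rnorm_ge0.
rewrite mulr_suml ler_sum // => i _; rewrite mulr_suml /amplify.
apply: (@le_trans _ _ (\sum_j rnorm (T i j (x j)))).
  elim/big_ind2: _ => [|u a v b ua vb|//]; first by rewrite rnorm0.
  by apply: le_trans (rnormD _ _) _; rewrite lerD.
apply: ler_sum => j _; apply: le_trans (bop_norm_le _ _) _.
by rewrite ler_wpM2l ?bop_opnorm_ge0 // le_l2norm //; apply: rnorm_ge0.
Qed.

Lemma bop_mxnorm_ge0 : 0 <= bop_mxnorm T.
Proof.
apply: opnorm_ge0 bop_amplify_bounded; first exact: l2norm_ge0.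
by apply: l2normZ; exact: rnormZ.
Qed.

Lemma le_bop_mxnorm (x : 'I_n -> H) :
  l2norm (@rnorm R H) (amplify (fun i j => T i j) x) <=
  bop_mxnorm T * l2norm (@rnorm R H) x.
Proof.
apply: le_opnorm bop_amplify_bounded.
- exact: l2norm_ge0.
- by apply: l2normZ; exact: rnormZ.
- by apply: l2norm_eq0; [exact: rnorm_eq0].
- by apply: amplify_scalable => i j c v; rewrite linearZ.
Qed.

End BopAmplify.

(** * Coordinates and compressions along a finite sequence *)

Section Compression.
Variables (R : realType) (H : hilbertType R).
Local Notation C := R[i].
Implicit Types (s : seq H) (x y : H) (t : bop H).

Lemma inner_conj x y : Num.conj (inner x y) = inner y x.
Proof. by rewrite [RHS](hermC inner) expr0 mul1r. Qed.

Lemma inner_suml (I : Type) (r : seq I) (P : pred I) (F : I -> H) y :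
  inner (\sum_(i <- r | P i) F i) y = \sum_(i <- r | P i) inner (F i) y.
Proof.
elim/big_rec2: _ => [|i c x _ <-]; first by rewrite linear0l.
by rewrite linearDl.
Qed.

Definition orthonormal_seq s :=
  forall i j : 'I_(size s), inner s`_i s`_j = (i == j)%:R.

Definition coords s x : 'cV[C]_(size s) := \col_i inner x s`_i.
Definition lincomb s (v : 'cV[C]_(size s)) : H := \sum_i v i 0 *: s`_i.
(** Membership in the span, encoded as being fixed by x |-> sum_i <x, s_i> s_i, which is the
    orthogonal projection when [s] is orthonormal. *)
Definition in_span s x := lincomb (coords s x) = x.
Definition compress s t : 'M[C]_(size s) := \matrix_(i, j) inner (t s`_j) s`_i.

Lemma coords_linear s : linear (coords s).
Proof.
by move=> c x y; apply/colP => i; rewrite !mxE linearDl linearZl_LR.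
Qed.
HB.instance Definition _ s :=
  GRing.isLinear.Build C H 'cV[C]_(size s) *:%R (coords s) (@coords_linear s).

Lemma lincomb_linear s : linear (@lincomb s).
Proof.
move=> c v w; rewrite /lincomb scaler_sumr -big_split; apply: eq_bigr => i _.
by rewrite !mxE scalerDl scalerA.
Qed.
HB.instance Definition _ s :=
  GRing.isLinear.Build C 'cV[C]_(size s) H *:%R (@lincomb s) (@lincomb_linear s).

(** Linear subspaces as predicates. Besides spans, this covers preimages of spans under
    operators. *)
Definition lin_closed (P : H -> Prop) :=
  P 0 /\ forall (c : C) x y, P x -> P y -> P (c *: x + y).

Lemma in_span_closed s : lin_closed (in_span s).
Proof.
split=> [|c x y xs ys]; first by rewrite /in_span !linear0.
by rewrite /in_span !linearP /= xs ys.
Qed.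

Lemma lin_closed_sum (P : H -> Prop) (I : Type) (r : seq I) (Q : pred I)
    (c : I -> C) (F : I -> H) : lin_closed P -> (forall i, P (F i)) ->
  P (\sum_(i <- r | Q i) c i *: F i).
Proof. by move=> [P0 PD] PF; elim/big_rec: _ => // i x _; apply: PD. Qed.

Lemma compressE s t v : compress s t *m v = coords s (t (lincomb v)).
Proof.
apply/colP => i; rewrite !mxE linear_sum inner_suml; apply: eq_bigr => j _.
by rewrite linearZ /= linearZl_LR !mxE mulrC.
Qed.

(** * Compressions to the span of an orthonormal sequence *)

Section Orthonormal.
Variable s : seq H.
Hypothesis s_on : orthonormal_seq s.
Local Notation lincomb := (@lincomb s).

Lemma lincombK : cancel lincomb (coords s).
Proof.
move=> v; apply/colP => i; rewrite mxE inner_suml (bigD1 i) //= big1 => [|j ji].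
  by rewrite linearZl_LR /= s_on eqxx mulr1 addr0.
by rewrite linearZl_LR /= s_on (negPf ji) mulr0.
Qed.

Lemma inner_lincomb x v : inner x (lincomb v) =
  \sum_i Num.conj (v i 0) * coords s x i 0.
Proof.
rewrite -inner_conj inner_suml rmorph_sum; apply: eq_bigr => i _.
by rewrite linearZl_LR rmorphM /= inner_conj mxE.
Qed.

Lemma rnorm_lincomb v : rnorm (lincomb v) = euclid v.
Proof.
apply/eqP; rewrite -(@eqrXn2 _ 2) ?rnorm_ge0 ?euclid_ge0 //.
apply/eqP/complexI; rewrite inner_rnorm inner_lincomb lincombK.
rewrite euclid_sqr rmorph_sum; apply: eq_bigr => i _.
by rewrite rmorphXn /= -rnormE normCKC.
Qed.

(** With p the projection of x, <x, p> is the squared norm of the coordinates and |p| is their norm.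
    Cauchy-Schwarz for x and p, divided by |p|, gives the bound. *)
Lemma bessel x : euclid (coords s x) <= rnorm x.
Proof.
have [->|v0] := eqVneq (euclid (coords s x)) 0; first exact: rnorm_ge0.
have vgt : 0 < euclid (coords s x) by rewrite lt_def v0 euclid_ge0.
rewrite -(ler_pM2r vgt) -{3}rnorm_lincomb; apply: le_trans (inner_le _ _).
rewrite -expr2 le_eqVlt; apply/orP; left; apply/eqP/complexI.
rewrite -rnormE inner_lincomb euclid_sqr; under [X in `|X|]eq_bigr do
  rewrite -normCKC rnormE -rmorphXn.
by rewrite -rmorph_sum ger0_norm // ler0c sumr_ge0 // => i _; apply: sqr_ge0.
Qed.

Lemma euclid_coords x : in_span s x -> euclid (coords s x) = rnorm x.
Proof. by move=> xs; rewrite -rnorm_lincomb xs. Qed.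

Lemma in_span_nth (i : 'I_(size s)) : in_span s s`_i.
Proof.
have -> : s`_i = lincomb (delta_mx i 0).
  rewrite /lincomb (bigD1 i) //= big1 => [|j /negPf ji].
    by rewrite !mxE !eqxx scale1r addr0.
  by rewrite mxE ji scale0r.
by rewrite /in_span lincombK.
Qed.

Lemma compress1 : compress s 1 = 1%:M.
Proof. by apply/matrixP => i j; rewrite !mxE s_on eq_sym. Qed.

Lemma compress_opnorm_le t : mx_opnorm (compress s t) <= opnorm (@rnorm R H) t.
Proof.
apply: mx_opnorm_le => [|v]; first exact: bop_opnorm_ge0.
rewrite compressE -(rnorm_lincomb v).
exact: le_trans (bessel _) (bop_norm_le _ _).
Qed.

(** The hypothesis says b P = P b P, so each b s_j can be expanded in [s] before t is applied. *)
Lemma compressM (t b : bop H) : (forall j : 'I_(size s), in_span s (b s`_j)) ->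
  compress s (t * b) = compress s t *m compress s b.
Proof.
move=> bs; apply/matrixP => i j; rewrite !mxE bopME -{1}(bs j) linear_sum.
rewrite inner_suml; apply: eq_bigr => k _.
by rewrite linearZ /= linearZl_LR !mxE mulrC.
Qed.

(** The (i, j) entry on the left is <t s_j, a s_i>, and a s_i expands in [s]. Invariance is needed
    for a itself, not for its adjoint. *)
Lemma compress_adjointM (a t : bop H) :
    (forall j : 'I_(size s), in_span s (a s`_j)) ->
  compress s (adjoint a * t) = map_mx Num.conj (compress s a)^T *m compress s t.
Proof.
move=> sa; apply/matrixP => i j; rewrite !mxE bopME.
rewrite -[LHS]inner_conj -adjointP inner_conj -(sa i) inner_lincomb.
by apply: eq_bigr => k _; rewrite !mxE.
Qed.

End Orthonormal.

(** * Orthonormalization of finite lists *)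

Lemma orthonormal_cons e s : inner e e = 1 -> coords s e = 0 ->
  orthonormal_seq s -> orthonormal_seq (e :: s).
Proof.
move=> ee es s_on i j.
have es0 (k : 'I_(size s)) : inner e s`_k = 0.
  by move/colP/(_ k): es; rewrite !mxE.
case: (unliftP ord0 i) => [i'|] ->; case: (unliftP ord0 j) => [j'|] -> /=.
- by rewrite s_on (inj_eq lift_inj).
- by rewrite -inner_conj es0 conjC0.
- by rewrite es0.
- by rewrite ee.
Qed.

(** The last clause says that every s_i lies in the span of [xs], in the form of an induction
    principle: a linear property of the generators passes to the basis. *)
Lemma gram_schmidt (xs : seq H) : exists s,
  [/\ orthonormal_seq s, forall x, x \in xs -> in_span s x &
    forall P, lin_closed P -> (forall x, x \in xs -> P x) ->
      forall i : 'I_(size s), P s`_i].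
Proof.
elim: xs => [|x xs [s [s_on sxs sP]]].
  by exists [::]; split=> // [|P _ _] [].
(* If x equals its projection p, then [s] already works; otherwise the normalized residual e is
   prepended. *)
set p := lincomb (coords s x); have [xp|xp] := eqVneq (x - p) 0.
  exists s; split=> // [z|P Plin Pxs]; last first.
    by apply: sP => // z zxs; apply: Pxs; rewrite inE zxs orbT.
  rewrite inE => /orP[/eqP ->|/sxs //].
  by apply/esym/eqP; rewrite -subr_eq0 -/p xp.
pose e := `|x - p|^-1 *: (x - p).
have n0 : `|x - p| != 0 by rewrite normr_eq0.
have xE : x = `|x - p| *: e + p by rewrite scalerA mulfV // scale1r subrK.
have es_on : orthonormal_seq (e :: s).
  apply: orthonormal_cons => //.
    rewrite linearZl_LR linearZr_LR /= -inner_normE fmorphV /=.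
    rewrite (CrealP (normr_real _)).
    by rewrite expr2 mulKf // mulVf.
  by rewrite linearZ linearB /= /p lincombK // subrr scaler0.
have span_s z : in_span s z -> in_span (e :: s) z.
  move=> <-; apply: lin_closed_sum; first exact: in_span_closed.
  by move=> i; apply: (in_span_nth es_on (lift ord0 i)).
exists (e :: s); split=> // [z|P Plin Pxs].
  rewrite inE => /orP[/eqP ->|/sxs/span_s //]; rewrite xE.
  apply: (in_span_closed _).2; first exact: (in_span_nth es_on ord0).
  by apply: span_s; rewrite /in_span lincombK.
have Ps : forall i : 'I_(size s), P s`_i.
  by apply: sP => // z zxs; apply: Pxs; rewrite inE zxs orbT.
(* As a combination of [s], p satisfies P, and hence so does e, a multiple of x - p. *)
have Pp : P p by apply: lin_closed_sum.
move=> i; case: (unliftP ord0 i) => [i'|] ->; first exact: Ps.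
rewrite /= -[e]addr0; apply: Plin.2 (Plin.1).
rewrite addrC -scaleN1r; apply: Plin.2 => //.
by apply: Pxs; rewrite mem_head.
Qed.

End Compression.

(** * The family of compressions to invariant subspaces *)

Section Representation.
Variables (R : realType) (H : hilbertType R) (A : set (bop H)).

Definition invariant_frame (s : seq H) : Prop :=
  [/\ (0 < size s)%N, orthonormal_seq s &
      forall a, A a -> forall i : 'I_(size s), in_span s (a s`_i)].

(** The index set: a subspace recurs once for each of its ordered orthonormal bases, which does not
    affect the supremum. *)
Definition frame := {s : seq H | invariant_frame s}.
Definition frame_size (l : frame) := size (sval l).
Implicit Type l : frame.

Lemma frame_gt0 l : (0 < frame_size l)%N.
Proof. by case: l => s []. Qed.

Lemma frame_orthonormal l : orthonormal_seq (sval l).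
Proof. by case: l => s []. Qed.

Lemma frame_invariant l a : A a ->
  forall i : 'I_(frame_size l), in_span (sval l) (a (sval l)`_i).
Proof. by case: (svalP l) => _ _; apply. Qed.

Fact compressions_bounded (t : bop H) : exists M : R, forall l,
  mx_opnorm (compress (sval l) t : 'M[R[i]]_(frame_size l)) <= M.
Proof.
exists (opnorm (@rnorm R H) t) => l.
exact/compress_opnorm_le/frame_orthonormal.
Qed.

Definition compressions (t : bop H) : mxprod R frame_size :=
  MxProd (compressions_bounded t).

Fact compressions_linear : linear compressions.
Proof.
move=> c t u; apply: mxprodE => l; apply/matrixP => i j.
by rewrite !mxE linearDl linearZl_LR.
Qed.
HB.instance Definition _ := GRing.isLinear.Build R[i] (bop H)
  (mxprod R frame_size) *:%R compressions compressions_linear.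

(** Orthonormalize [xs] together with all a_i x, where the a_i span A. The span is invariant because
    b x is a combination of the a_i x and b (a_i x) = (b a_i) x with b a_i in A. *)
Lemma ex_frame (xs : seq H) : operator_algebra A -> finite_dimensional A ->
  (exists2 x, x \in xs & x != 0) ->
  exists l, forall x, x \in xs -> in_span (sval l) x.
Proof.
move=> [_ _ AM _] [m [a AE]] [x0 x0s x0N].
have Aa i : A (a i).
  rewrite AE; exists (fun j => (j == i)%:R) => //.
  rewrite (bigD1 i) //= eqxx scale1r big1 ?addr0 // => j /negPf ->.
  by rewrite scale0r.
have [s [s_on sxs sP]] :=
  gram_schmidt (xs ++ [seq a i x | i <- enum 'I_m, x <- xs]).
have xs_s x : x \in xs -> in_span s x.
  by move=> xxs; apply: sxs; rewrite mem_cat xxs.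
have sA : forall b, A b -> forall i : 'I_(size s), in_span s (b s`_i).
  have AxsP b x : A b -> x \in xs -> in_span s (b x).
    rewrite AE => -[c _ <-] xxs.
    have -> : (\sum_i c i *: a i) x = \sum_i c i *: a i x.
      by elim/big_rec2: _ => // i u v _ <-; rewrite bopDE bopZE.
    apply: lin_closed_sum; first exact: in_span_closed.
    move=> i; apply: sxs; rewrite mem_cat; apply/orP; right.
    by apply/allpairsP; exists (i, x); rewrite mem_enum.
  (* The vectors that b maps into the span form a subspace, so only the generators need checking. *)
  move=> b Ab; apply: (sP (fun z => in_span s (b z))).
    split; first by rewrite linear0; apply: (in_span_closed s).1.
    by move=> c y z yP zP; rewrite linearP; apply: (in_span_closed s).2.
  move=> x; rewrite mem_cat => /orP[|/allpairsP[[i y] /= [_ ys ->]]].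
    exact: AxsP.
  by rewrite -bopME; apply: AxsP => //; apply: AM.
(* An empty [s] would span only 0, but x0 is a nonzero vector in the span. *)
suff s0 : (0 < size s)%N by exists (exist _ s (And3 s0 s_on sA)).
case: (posnP (size s)) => // /size0nil s0; case/eqP: x0N.
by move: (xs_s _ x0s); rewrite s0 => <-; rewrite /lincomb big_ord0.
Qed.

Lemma compressions_completely_isometric :
  operator_algebra A -> finite_dimensional A -> completely_isometric compressions.
Proof.
move=> hA hfd n T; set S := mxprod_mxnorm _.
pose cT l := amplify (fun i j (v : 'cV[R[i]]_(frame_size l)) =>
  map_mx compressions T i j l *m v).
(* With V the isometry [lincomb], applied entrywise, the compressed matrix is V^* T V; [cT_le]
   follows since V^* is a contraction. *)
have cTE l x i : cT l x i =
    coords (sval l) (amplify (fun i j => T i j) (fun j => lincomb (x j)) i).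
  rewrite /cT /amplify linear_sum; apply: eq_bigr => j _.
  by rewrite mxE compressE.
have cT_le l (x : 'I_n -> 'cV[R[i]]_(frame_size l)) :
    l2norm (@euclid R _) (cT l x) <= bop_mxnorm T * l2norm (@euclid R _) x.
  have -> : l2norm (@euclid R _) x =
      l2norm (@rnorm R H) (fun i => lincomb (x i)).
    congr Num.sqrt; apply: eq_bigr => i _.
    by rewrite (rnorm_lincomb (@frame_orthonormal l)).
  apply: le_trans (le_bop_mxnorm _ _); apply: ler_wsqrtr.
  apply: ler_sum => i _; rewrite ler_pXn2r ?nnegrE ?euclid_ge0 ?rnorm_ge0 //.
  rewrite cTE; exact: (bessel (@frame_orthonormal l)).
have cTop l : opnorm (l2norm (@euclid R _)) (cT l) <= bop_mxnorm T.
  apply: opnorm_le => //; last exact: bop_mxnorm_ge0.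
  by apply: l2normZ; exact: euclidZ.
have cTop0 l : 0 <= opnorm (l2norm (@euclid R _)) (cT l).
  apply: opnorm_ge0; first exact: l2norm_ge0.
    by apply: l2normZ; exact: euclidZ.
  by exists (bop_mxnorm T).
have cTS l : opnorm (l2norm (@euclid R _)) (cT l) <= S.
  apply: ub_le_sup; last by exists l.
  by exists (bop_mxnorm T) => _ [k _ <-].
(* Without frames S is the supremum of the empty set, whose value is 0. *)
have S_empty : ~ (exists l : frame, True) -> S = 0.
  move=> L0; rewrite -(@sup0 R); congr sup.
  by apply/seteqP; split=> // t [l _ _]; case: L0; exists l.
have S0 : 0 <= S.
  have [[l _]|L0] := pselect (exists l : frame, True).
    exact: le_trans (cTop0 l) (cTS l).
  by rewrite S_empty.
apply/le_anti/andP; split.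
  have [[l _]|L0] := pselect (exists l : frame, True); last first.
    by rewrite S_empty // bop_mxnorm_ge0.
  apply: ge_sup; first by exists (opnorm (l2norm (@euclid R _)) (cT l)), l.
  by move=> _ [k _ <-]; apply: cTop.
apply: opnorm_le => [||x] //; first by apply: l2normZ; exact: rnormZ.
set y := amplify _ x.
(* A zero x provides no nonzero vector for a frame, but then y = 0 as well. *)
have [[i xi]|x0] := pselect (exists i, x i != 0); last first.
  suff -> : l2norm (@rnorm R H) y = 0 by rewrite mulr_ge0 ?l2norm_ge0.
  rewrite /l2norm big1 ?sqrtr0 // => i _; rewrite /y /amplify big1 ?rnorm0.
    by rewrite expr0n.
  move=> j _; have -> : x j = 0; last exact: linear0.
  by apply/eqP/negPn/negP => xj; apply: x0; exists j.
(* One frame contains the entries of both x and y = T x, so passing to coordinates preserves both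
   norms. *)
have [|l lP] := @ex_frame (codom x ++ codom y) hA hfd.
  by exists (x i); rewrite ?mem_cat ?codom_f.
have xl j : in_span (sval l) (x j) by apply: lP; rewrite mem_cat codom_f.
have yl j : in_span (sval l) (y j).
  by apply: lP; rewrite mem_cat codom_f orbT.
pose v j : 'cV[R[i]]_(frame_size l) := coords (sval l) (x j).
have -> : l2norm (@rnorm R H) x = l2norm (@euclid R _) v.
  congr Num.sqrt; apply: eq_bigr => j _.
  by rewrite (euclid_coords (@frame_orthonormal l)).
have -> : l2norm (@rnorm R H) y = l2norm (@euclid R _) (cT l v).
  congr Num.sqrt; apply: eq_bigr => j _; rewrite cTE.
  have -> : (fun j => lincomb (v j)) = x by apply/funext => k; apply: xl.
  by rewrite (euclid_coords (@frame_orthonormal l)).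
apply: (@le_trans _ _
    (opnorm (l2norm (@euclid R _)) (cT l) * l2norm (@euclid R _) v)).
  apply: le_opnorm; last by exists (bop_mxnorm T).
  - exact: l2norm_ge0.
  - by apply: l2normZ; exact: euclidZ.
  - by apply: l2norm_eq0; exact: euclid_eq0.
  - by apply: amplify_scalable => j k c w; rewrite scalemxAr.
by rewrite ler_wpM2r ?l2norm_ge0.
Qed.

End Representation.

(** * The representation and its multiplicativity *)

Theorem theorem3p7 (R : realType) (H : hilbertType R) (A : set (bop H))
    (hA : operator_algebra A) (hfd : finite_dimensional A) :
  exists (L : Type) (r : L -> nat) (Psi : {linear bop H -> mxprod R r}),
    [/\ forall l, (0 < r l)%N,
        Psi 1 = 1,
        completely_isometric Psi,
        forall a (t : bop H) b, A a -> A b ->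
          Psi (adjoint a * t * b) = mxprod_adj (Psi a) * Psi t * Psi b &
        forall a b, A a -> A b -> Psi (a * b) = Psi a * Psi b].
Proof.
exists (frame A), (@frame_size R H A), (@compressions R H A); split.
- exact: frame_gt0.
- by apply: mxprodE => l; apply/compress1/frame_orthonormal.
- exact: compressions_completely_isometric.
- move=> a t b Aa Ab; apply: mxprodE => l.
  have al := frame_invariant (l := l) Aa; have bl := frame_invariant (l := l) Ab.
  (* Invariance under b splits off the right factor; invariance under a then splits off the adjoint
     on the left. *)
  by rewrite /= compressM // compress_adjointM.
- move=> a b _ Ab; apply: mxprodE => l.
  exact: compressM (frame_invariant (l := l) Ab).
Qed.
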